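(* Let $n\geqslant 2$ and let $r_1,\ldots,r_n$ be nonnegative integers. Then the tree $S(r_1,\ldots,r_n)$ is not integral.
   Context: Eigenvalues are adjacency eigenvalues; a graph is integral if all its eigenvalues are integers. For $n\geqslant1$ and nonnegative integers $r_1,\ldots,r_n$, let $C(r_1,\ldots,r_n)$ be the tree obtained from the path with vertices $v_1,v_2,\ldots,v_{2n+1}$ (in order) by attaching $r_i$ new pendant vertices (leaves) to $v_{2i}$ for each $i=1,\ldots,n$. The tree $S(r_1,\ldots,r_n)$ is obtained from $C(r_1,\ldots,r_n)$ by attaching one new pendant vertex to each vertex of degree $1$ of $C(r_1,\ldots,r_n)$ and to each of the vertices $v_3,v_5,\ldots,v_{2n-1}$. The vertices $v_2,v_4,\ldots,v_{2n}$ are called the central vertices. *)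

(* Defs.v *)
From HB Require Import structures.
From mathcomp Require Import all_boot all_order all_algebra all_field.

Set Implicit Arguments.
Unset Strict Implicit.
Unset Printing Implicit Defensive.

Import GRing.Theory Num.Theory.
Local Open Scope ring_scope.

(* A finite simple graph is a symmetric irreflexive relation on a finType.    *)

Definition adjmx (T : finType) (e : rel T) : 'M[algC]_#|T| :=
  \matrix_(i, j) (e (enum_val i) (enum_val j))%:R.

Definition integral_graph (T : finType) (e : rel T) : Prop :=
  forall a : algC, eigenvalue (adjmx e) a -> a \in Num.int.

Definition degree (T : finType) (e : rel T) (x : T) : nat := #|[pred y | e x y]|.

Local Open Scope nat_scope.

(* attach e k is e with k x new pendant vertices attached to each vertex x;   *)
(* inr (Tagged _ i), tagged by x, is the i-th new neighbour of x.             *)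
Definition attachV (T : finType) (k : T -> nat) : finType :=
  (T + {x : T & 'I_(k x)})%type.

Definition attach (T : finType) (e : rel T) (k : T -> nat) : rel (attachV k) :=
  fun u v => match u, v with
  | inl x, inl y => e x y
  | inl x, inr p => x == tag p
  | inr p, inl y => tag p == y
  | inr _, inr _ => false
  end.

Definition path_graph (m : nat) : rel 'I_m :=
  fun i j => (i.+1 == j :> nat) || (j.+1 == i :> nat).

(* Path vertices v_1, v_2, ... are the ordinals 0, 1, ... Hence the central   *)
(* vertex v_(2i) is the odd ordinal j = 2i - 1, and r_i is the entry i - 1,   *)
(* that is j./2, of the tuple r.                                              *)
Section Trees.
Variables (n : nat) (r : n.-tuple nat).

Definition C_pendants (j : 'I_(n.*2.+1)) : nat := if odd j then nth 0 r j./2 else 0.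

Definition C_vertex : finType := attachV C_pendants.

Definition C_tree : rel C_vertex := attach (@path_graph n.*2.+1) (k := C_pendants).

(* v_3, v_5, ..., v_(2n-1), i.e. the even ordinals 2, 4, ..., 2n - 2. *)
Definition inner_odd (u : C_vertex) : bool :=
  if u is inl j then ~~ odd j && (0 < j < n.*2) else false.

Definition S_pendants (u : C_vertex) : nat := (degree C_tree u == 1) || inner_odd u.

Definition S_vertex : finType := attachV S_pendants.

Definition S_tree : rel S_vertex := attach C_tree (k := S_pendants).

End Trees.

Lemma attach_sym (T : finType) (e : rel T) (k : T -> nat) :
  symmetric e -> symmetric (attach e (k := k)).
Proof. by move=> es [x|p] [y|q] //=; rewrite eq_sym. Qed.

Lemma attach_irr (T : finType) (e : rel T) (k : T -> nat) :
  irreflexive e -> irreflexive (attach e (k := k)).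
Proof. by move=> ei [x|p] /=. Qed.

Lemma path_graph_sym m : symmetric (@path_graph m).
Proof. by move=> i j; rewrite /path_graph orbC. Qed.

Lemma path_graph_irr m : irreflexive (@path_graph m).
Proof. by move=> i; rewrite /path_graph orbb gtn_eqF. Qed.

Lemma S_tree_sym n (r : n.-tuple nat) : symmetric (@S_tree n r).
Proof. exact/attach_sym/attach_sym/path_graph_sym. Qed.

Lemma S_tree_irr n (r : n.-tuple nat) : irreflexive (@S_tree n r).
Proof. exact/attach_irr/attach_irr/path_graph_irr. Qed.

(* Main.v *)
Require Import Defs.
From mathcomp Require Import all_boot all_order all_algebra all_field.
From mathcomp Require Import zify ring.

Set Implicit Arguments.
Unset Strict Implicit.
Unset Printing Implicit Defensive.

Import Order.TTheory GRing.Theory Num.Theory.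
Local Open Scope ring_scope.
Local Open Scope sesquilinear_scope.

(** Write [d_k = r_k + 2] for the degree of the [k]-th central vertex and [J] for
the Jacobi matrix with diagonal [d] and off-diagonal entries [1]. Eliminating the
non-central vertices from the eigenvector equation shows that, if [mu <> 0] is an
eigenvalue of [J] and [la ^ 2 = mu + 1], then [la] is an eigenvalue of the tree.
If the tree is integral, every eigenvalue [mu >= 1] of [J] is thus [q ^ 2 - 1] with
[q >= 2], and two distinct ones differ by at least 5.

Let [d_i] be the largest diagonal entry and [mu] the largest eigenvalue of [J].
A Rayleigh quotient gives [mu > d_i], hence [mu >= d_i + 1]. For [j <> i], the span
of [e_i] and [e_j] yields a second eigenvalue [>= d_j - 1]; since [J] has simple
spectrum, it is [<= mu - 5], so that [mu >= d_j + 4]. But then [mu] lies outside the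
Gershgorin discs of a diagonal rescaling of [J]. *)

(** * Adjacency sums over path graphs and attached leaves *)

Lemma eigenvalue_adjmx (T : finType) (e : rel T) (x : T -> algC) (a : algC) u0 :
    symmetric e -> (forall u, \sum_v (e u v)%:R * x v = a * x u) -> x u0 != 0 ->
  eigenvalue (adjmx e) a.
Proof.
move=> e_sym xP xu0; apply/eigenvalueP; exists (\row_i x (enum_val i)).
  apply/rowP=> j; rewrite !mxE -xP (reindex (@enum_val _ T)) /=.
    by apply: eq_bigr => i _; rewrite !mxE e_sym mulrC.
  by apply: onW_bij; apply: enum_val_bij.
apply: contraNneq xu0 => /rowP/(_ (enum_rank u0)).
by rewrite !mxE enum_rankK => ->.
Qed.

Lemma sum_attach_inl (R : pzSemiRingType) (T : finType) (e : rel T) (k : T -> nat)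
    (x : attachV k -> R) (a : T) :
  \sum_v (attach e (inl a) v)%:R * x v =
  \sum_b (e a b)%:R * x (inl b) + \sum_(i < k a) x (inr (Tagged (fun b => 'I_(k b)) i)).
Proof.
rewrite /attachV big_sumType /=; congr (_ + _).
under eq_bigr do rewrite mulr_natl mulrb.
rewrite -big_mkcond /=.
transitivity (\sum_(b | b == a) \sum_(i < k b) x (inr (Tagged (fun b => 'I_(k b)) i))).
  rewrite (sig_big_dep (fun b => b == a) (fun _ _ => true)
             (fun b (i : 'I_(k b)) => x (inr (Tagged (fun b => 'I_(k b)) i)))) /=.
  by apply: eq_big => [[b i]|[b i] _] //=; rewrite ?andbT eq_sym.
by rewrite big_pred1_eq.
Qed.

Lemma sum_attach_inr (R : pzSemiRingType) (T : finType) (e : rel T) (k : T -> nat)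
    (x : attachV k -> R) p :
  \sum_v (attach e (inr p) v)%:R * x v = x (inl (tag p)).
Proof.
rewrite /attachV big_sumType /= [X in _ + X]big1 => [|i _]; last exact: mul0r.
rewrite addr0; under eq_bigr do rewrite mulr_natl mulrb eq_sym.
by rewrite -big_mkcond /= big_pred1_eq.
Qed.

(** Taking [g] on [nat] lets [j.-1] and [j.+1] appear without bounds; the boolean multiplicities
    drop the neighbours missing at the ends. *)
Lemma sum_path_graph (R : pzSemiRingType) m (g : nat -> R) (j : 'I_m) :
  \sum_i (path_graph j i)%:R * g i = g j.-1 *+ (0 < j)%N + g j.+1 *+ (j.+1 < m)%N.
Proof.
transitivity (\sum_(i < m) (g i *+ (i.+1 == j) + g i *+ (j.+1 == i))).
  apply: eq_bigr => i _; rewrite mulr_natl /path_graph.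
  case: (j.+1 =P i :> nat) => ji; case: (i.+1 =P j :> nat) => ij /=;
    rewrite ?add0r ?addr0 //; lia.
rewrite big_split /=; congr (_ + _).
  case: (posnP j) => [-> |j0]; first by rewrite big1.
  have jm : (j.-1 < m)%N by have := ltn_ord j; lia.
  rewrite (bigD1 (Ordinal jm)) //= prednK // eqxx big1 ?addr0 // => i.
  by rewrite -val_eqE /= => ij; case: eqP => //; lia.
have [jm|jm] := ltnP j.+1 m; last first.
  by rewrite big1 // => i _; case: eqP => //; have := ltn_ord i; lia.
rewrite (bigD1 (Ordinal jm)) //= eqxx big1 ?addr0 // => i.
by rewrite -val_eqE /= eq_sym => /negbTE ->.
Qed.

(** The degree is the neighbour sum of the constant vector 1, so the sum lemmas above also compute
    degrees. *)
Lemma degreeE (R : pzSemiRingType) (T : finType) (e : rel T) u :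
  (degree e u)%:R = \sum_v (e u v)%:R * 1 :> R.
Proof.
rewrite /degree -sum1_card natr_sum big_mkcond /=.
by apply: eq_bigr => v _; rewrite inE mulr1; case: (e u v).
Qed.

(** * Lifting eigenvectors of [J] to the tree *)

Section Tree.
Variables (n : nat) (r : n.-tuple nat).
Hypothesis n_gt0 : (0 < n)%N.

Definition central (u : C_vertex r) : bool := if u is inl j then odd j else false.

(** The ends of the path and the pendants of [C_tree] have degree 1, the inner even ordinals are
    listed in [inner_odd], and central vertices have degree at least 2. *)
Lemma S_pendantsE u : S_pendants u = ~~ central u :> nat.
Proof.
rewrite /S_pendants; congr nat_of_bool; case: u => [j|p] /=; last first.
  rewrite -(eqr_nat int) degreeE /C_tree.
  by rewrite (sum_attach_inr _ (fun=> 1)) eqxx.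
have -> : degree (@C_tree n r) (inl j) =
    ((0 < j)%N + (j.+1 < n.*2.+1)%N + C_pendants r j)%N.
  apply/eqP; rewrite -(eqr_nat int) degreeE /C_tree.
  rewrite (sum_attach_inl _ (fun=> 1)) (sum_path_graph (fun=> 1)).
  by rewrite sumr_const card_ord !natrD.
rewrite /C_pendants; have := ltn_ord j; case: (boolP (odd j)) => /=; lia.
Qed.

Variables (F : nat -> algC) (mu la : algC).
Hypotheses (F0 : F 0%N = 0) (Fn : F n.+1 = 0).
Hypothesis FP : forall k, (k < n)%N ->
  mu * F k.+1 = (nth 0%N r k).+2%:R * F k.+1 + F k + F k.+2.
Hypothesis la2 : la ^+ 2 = mu + 1.

(* The sum of the values of the eigenvector of [J] at the central neighbours of a
   non-central vertex; a junk value at central vertices. *)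
Definition nbr_sum (u : C_vertex r) : algC :=
  match u with
  | inl j => F j./2 + F j./2.+1
  | inr p => F (uphalf (tag p))
  end.

(** Let a non-central vertex have value [x], its new leaf [z], and let its central neighbours sum to
    [mu * s]. The equations [la * z = x] and [la * x = z + mu * s] are solved by [z = s],
    [x = la * s], because [la ^ 2 = mu + 1]. *)
Definition path_vec (j : nat) : algC :=
  if odd j then mu * F (uphalf j) else la * (F j./2 + F j./2.+1).

Definition C_vec (u : C_vertex r) : algC :=
  if u is inl j then path_vec j else la * nbr_sum u.

Definition S_vec (u : S_vertex r) : algC :=
  match u with inl c => C_vec c | inr p => nbr_sum (tag p) end.

Lemma S_vecP u : \sum_v (S_tree u v)%:R * S_vec v = la * S_vec u.
Proof.
rewrite /S_tree; case: u => [c|[c i]]; last first.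
  rewrite sum_attach_inr /=; move: i; rewrite S_pendantsE.
  case: c => [j|p] //=; rewrite /path_vec.
  by case: (boolP (odd j)) => [_ []|].
rewrite sum_attach_inl sumr_const card_ord S_pendantsE.
change (\sum_b (C_tree c b)%:R * C_vec b + nbr_sum c *+ ~~ central c
        = la * C_vec c).
rewrite /C_tree; case: c => [j|[j i]]; last first.
  rewrite sum_attach_inr /=; move: i; rewrite /C_pendants /path_vec.
  case: (boolP (odd j)) => [jodd _|_]; last by case.
  by rewrite mulr1n mulrA -expr2 la2 mulrDl mul1r.
rewrite sum_attach_inl (sum_path_graph path_vec) /= sumr_const card_ord /C_pendants /path_vec.
case: (boolP (odd j)) => jodd.
  have j_lt := ltn_ord j; have k_lt : (j./2 < n)%N by lia.
  have -> : odd j.-1 = false by lia.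
  have -> : odd j.+1 = false by lia.
  have -> : (0 < j)%N by lia.
  have -> : (j.+1 < n.*2.+1)%N by lia.
  have -> : (j.-1)./2 = j./2 by lia.
  have -> : (j.+1)./2 = j./2.+1 by lia.
  have -> : uphalf j = j./2.+1 by lia.
  (* Each of the two path neighbours and each of the [r_k] pendants contributes [la * F k.+1],
     whence [d_k = r_k + 2]. *)
  rewrite (FP k_lt) /= !mulr1n mulr0n addr0 -mulr_natl -2!natr1.
  ring.
have j_lt := ltn_ord j.
have -> : odd j.+1 by lia.
have -> : uphalf j.+1 = j./2.+1 by lia.
(* An end of the path has a single central neighbour; [F 0 = 0] and [F n.+1 = 0] stand in for the
   missing one. *)
have -> : (if odd j.-1 then mu * F (uphalf j.-1) else la * (F (j.-1)./2 + F (j.-1)./2.+1)) *+ (0 < j)%N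
   = mu * F j./2.
  case: (posnP j) => [-> |j0]; first by rewrite F0 mulr0.
  by have -> : odd j.-1 by [lia]; have -> : uphalf j.-1 = j./2 by lia.
have -> : mu * F j./2.+1 *+ (j.+1 < n.*2.+1)%N = mu * F j./2.+1.
  case: ltnP => // ?; have -> : j./2 = n by lia.
  by rewrite Fn mulr0.
by rewrite !mulr0n addr0 mulr1n mulrA -expr2 la2; ring.
Qed.

Lemma S_tree_eigenvalue k : (k < n)%N -> F k.+1 != 0 -> mu != 0 ->
  eigenvalue (adjmx (@S_tree n r)) la.
Proof.
move=> k_lt Fk mu0; have j_lt : (k.*2.+1 < n.*2.+1)%N by lia.
apply: (@eigenvalue_adjmx _ _ S_vec _ (inl (inl (Ordinal j_lt)))).
- exact: S_tree_sym.
- exact: S_vecP.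
rewrite /= /path_vec /= odd_double /= mulf_neq0 //.
by rewrite doubleK.
Qed.

End Tree.

(** * Rayleigh quotients in an orthonormal eigenbasis *)

Section Rayleigh.
Variables (C : numClosedFieldType) (n : nat) (A : 'M[C]_n).
Hypothesis A_herm : A \is hermsymmx.

Let P := spectralmx A.
Let D := spectral_diag A.

Lemma row_spectralmx_eigen k : row k P *m A = D 0 k *: row k P.
Proof.
have /hermitian_normalmx/orthomx_spectralP AE := A_herm.
rewrite {1}AE -/P -/D -row_mul !mulmxA mulmxV ?spectral_unit // mul1mx.
by rewrite row_mul row_diag_mx -scalemxAl -rowE.
Qed.

Lemma row_spectralmx_neq0 k : row k P != 0.
Proof.
have /row_freeP[Q PQ] : row_free P by rewrite row_free_unit spectral_unit.
apply/eqP => rk0; have /rowP/(_ k) : row k (P *m Q) = 0.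
  by rewrite row_mul rk0 mul0mx.
by rewrite PQ !mxE eqxx => /eqP; rewrite oner_eq0.
Qed.

Lemma spectral_diag_real k : D 0 k \is Num.real.
Proof. by have /mxOverP -> := hermitian_spectral_diag_real A_herm. Qed.

(** With [u] the coordinates of [v] in the eigenbasis, the hypothesis says that the sum of
    [(c - D 0 l) * |u_l| ^ 2] is at most 0. If [D 0 l < c] wherever [u_l] is nonzero, then [u = 0].
    Keeping [u_l] nonzero in the conclusion allows an eigenvector orthogonal to [v] to be
    excluded. *)
Lemma rayleigh_spectral_diag (v : 'rV[C]_n) (c : C) :
    c \is Num.real -> v != 0 ->
    c * (v *m v^t*) 0 0 <= (v *m A *m v^t*) 0 0 ->
  exists2 l, (v *m P^t*) 0 l != 0 & c <= D 0 l.
Proof.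
move=> c_real v_neq0 cv.
have PU : P \is unitarymx by apply: spectral_unitarymx.
have /hermitian_normalmx/orthomx_spectralP AE := A_herm.
pose u := v *m P^t*; have uE : v = u *m P.
  by rewrite /u -mulmxA -invmx_unitary // mulVmx ?mulmx1 ?spectral_unit.
have utC : u^t* = P *m v^t*.
  by rewrite /u trmx_mul map_mxM /= trmxCK.
have vvE : (v *m v^t*) 0 0 = \sum_l `|u 0 l| ^+ 2.
  rewrite {1}uE -mulmxA -utC mxE; apply: eq_bigr => l _.
  by rewrite !mxE normCK.
have vAvE : (v *m A *m v^t*) 0 0 = \sum_l D 0 l * `|u 0 l| ^+ 2.
  rewrite AE invmx_unitary // -/P !mulmxA -/u -mulmxA -utC mxE.
  apply: eq_bigr => l _; rewrite mul_mx_diag !mxE normCK; ring.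
have [/existsP[l /andP[ul cl]]|/existsPn all_lt] :=
  boolP [exists l, (u 0 l != 0) && (c <= D 0 l)]; first by exists l.
have term_ge0 l : true -> 0 <= (c - D 0 l) * `|u 0 l| ^+ 2.
  move=> _; have := all_lt l; have [->|_] /= := eqVneq (u 0 l) 0.
    by rewrite normr0 expr0n mulr0.
  rewrite -real_ltNge ?spectral_diag_real // => /ltW cl.
  by rewrite mulr_ge0 ?subr_ge0 ?exprn_ge0.
have u0 : u = 0.
  have : \sum_l (c - D 0 l) * `|u 0 l| ^+ 2 == 0.
    rewrite eq_le sumr_ge0 // andbT; under eq_bigr do rewrite mulrBl.
    by rewrite sumrB -mulr_sumr -vvE -vAvE subr_le0.
  rewrite psumr_eq0 // => /allP eq0; apply/rowP => l; rewrite [RHS]mxE.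
  have := all_lt l; have [//|ul /= clN] := eqVneq (u 0 l) 0.
    have := eq0 l (mem_index_enum _).
  rewrite mulf_eq0 expf_eq0 /= normr_eq0 (negbTE ul) orbF subr_eq0 => /eqP cl.
  by rewrite cl lexx in clN.
by rewrite uE u0 mul0mx eqxx in v_neq0.
Qed.

End Rayleigh.

Lemma quadratic_form_delta2 (C : numClosedFieldType) n (A : 'M[C]_n) i j (a b : C) :
  let v : 'rV[C]_n := a *: delta_mx 0 i + b *: delta_mx 0 j in
  (v *m A *m v^t*) 0 0 =
  A i i * `|a| ^+ 2 + A j j * `|b| ^+ 2 + (A i j * (a * b^*) + A j i * (b * a^*)).
Proof.
move=> v; have -> : v^t* = a^* *: delta_mx i 0 + b^* *: delta_mx j 0.
  rewrite /v; apply/matrixP => k l; rewrite !mxE rmorphD !rmorphM !rmorph_nat.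
  by rewrite !(andbC (l == 0)).
rewrite mulmxDl mulmxDr !mulmxDl -!scalemxAl -!scalemxAr -!rowE -!colE !mxE !normCK.
ring.
Qed.

(** Provides a nonzero vector in a plane orthogonal to a given eigenvector. *)
Lemma exists_linear_relation2 (C : fieldType) (p q : C) :
  exists a b : C, (a != 0) || (b != 0) /\ a * p + b * q = 0.
Proof.
have [->|p0] := eqVneq p 0; first by exists 1, 0; rewrite oner_eq0 mulr0 mul0r addr0.
by exists q, (- p); rewrite oppr_eq0 p0 orbT; split=> //; ring.
Qed.

(** * Jacobi matrices: recurrence, Gershgorin bound, simple spectrum *)

Section Jacobi.
Variables (n : nat) (d : nat -> nat).

Definition jacobi : 'M[algC]_n :=
  \matrix_(i, j) ((d i)%:R *+ (i == j) + (path_graph i j)%:R).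

(* The entries of [y] occupy the positions [1 .. n]: with the values 0 at [0] and
   [n.+1], the eigenvector equation takes the same form at the end points. *)
Definition padded (y : 'rV[algC]_n) (k : nat) : algC :=
  if k is k'.+1 then oapp (y 0) 0 (insub k') else 0.

Lemma paddedS y (i : 'I_n) : padded y i.+1 = y 0 i.
Proof. by rewrite /= valK. Qed.

Lemma padded_gtn y k : (n < k)%N -> padded y k = 0.
Proof. by case: k => //= k; rewrite ltnS leqNgt => nk; rewrite insubN. Qed.

Lemma jacobi_herm : jacobi \is hermsymmx.
Proof.
apply: realsym_hermsym; last first.
  by apply/mxOverP => i j; rewrite !mxE -mulrnA -natrD realn.
apply/is_hermitianmxP; rewrite expr0 scale1r map_mx_id //.
apply/matrixP => i j; rewrite !mxE path_graph_sym eq_sym.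
by case: eqP => [->|].
Qed.

Lemma mulmx_jacobi y (j : 'I_n) :
  (y *m jacobi) 0 j = (d j)%:R * padded y j.+1 + padded y j + padded y j.+2.
Proof.
rewrite mxE -addrA; under eq_bigr do rewrite !mxE mulrDr.
rewrite big_split /=; congr (_ + _).
  rewrite (bigD1 j) //= eqxx big1 => [|i /negbTE ->]; last by rewrite mulr0n mulr0.
  by rewrite addr0 mulr1n mulrC valK.
transitivity (\sum_i (path_graph j i)%:R * padded y i.+1).
  by apply: eq_bigr => i _; rewrite paddedS mulrC path_graph_sym.
rewrite (sum_path_graph (fun k => padded y k.+1)); congr (_ + _).
  by case: (nat_of_ord j) => //= k; rewrite mulr1n.
by rewrite -[RHS]/(padded y j.+2); case: ltnP => // jn; rewrite padded_gtn.
Qed.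

Section Eigenvector.
Variables (y : 'rV[algC]_n) (mu : algC).
Hypothesis yP : y *m jacobi = mu *: y.

Lemma jacobi_eigenP k : (k < n)%N ->
  mu * padded y k.+1 = (d k)%:R * padded y k.+1 + padded y k + padded y k.+2.
Proof.
move=> kn; have := mulmx_jacobi y (Ordinal kn).
by rewrite yP mxE -paddedS.
Qed.

(** The three-term recurrence determines all entries from the first. *)
Lemma jacobi_eigen_eq0 : padded y 1 = 0 -> y = 0.
Proof.
move=> y1; suff H k : (k <= n)%N -> padded y k = 0 /\ padded y k.+1 = 0.
  by apply/rowP => i; rewrite mxE -paddedS; have [|_] := H i; first exact: ltnW.
elim: k => [//|k IH] kn; have [|k0 k1] := IH; first exact: ltnW.
split=> //; have := jacobi_eigenP kn.
by rewrite k0 k1 !mulr0 !add0r => <-.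
Qed.

(* Gershgorin's argument with the weight 2 at [i] and 5 elsewhere: it bounds
   [mu - d_i] by [2 * 2/5 < 1] and [mu - d_j] by [1 + 5/2 < 4]. *)
Lemma jacobi_eigen_gershgorin (i : 'I_n) :
    1 <= mu - (d i)%:R -> (forall j : 'I_n, j != i -> 4 <= mu - (d j)%:R) ->
  y = 0.
Proof.
move=> mu_i mu_j; pose t (j : 'I_n) : algC := `|y 0 j| *+ (if j == i then 2 else 5).
have [j _ tj] := @real_arg_maxP _ _ i xpredT t isT
  (fun j _ => ger0_real (mulrn_wge0 _ (normr_ge0 _))).
set T := t j; have T_ge0 : 0 <= T by apply: mulrn_wge0.
(* The entry at [i] is at most [T / 2] and any other at most [T / 5]; the factor 10 clears
   denominators, and padding shifts [i] to [i.+1]. *)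
have padT k : `|padded y k| *+ 10 <= T *+ (if k == i.+1 then 5 else 2).
  case: k => [|k]; first by rewrite normr0 mul0rn mulrn_wge0.
  have [kn|kn] := ltnP k n; last by rewrite padded_gtn // normr0 mul0rn mulrn_wge0.
  have kT : t (Ordinal kn) <= T := tj _ isT.
  move: kT; rewrite [t (Ordinal kn)]/t -(paddedS y (Ordinal kn)) -val_eqE eqSS.
  rewrite -[val (Ordinal kn)]/k; case: (k == i) => kT.
    by have := ler_wMn2r 5 kT; rewrite -mulrnA.
  by have := ler_wMn2r 2 kT; rewrite -mulrnA.
have Ej : `|mu - (d j)%:R| * `|padded y j.+1| <= `|padded y j| + `|padded y j.+2|.
  rewrite -normrM (_ : _ * _ = padded y j + padded y j.+2) ?ler_normD //.
  by rewrite mulrBl jacobi_eigenP //; ring.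
have Ecj (c : nat) : c%:R <= mu - (d j)%:R ->
    `|padded y j.+1| *+ 10 *+ c <=
    T *+ ((if j == i.+1 :> nat then 5 else 2) + (if j.+2 == i.+1 then 5 else 2)).
  move=> cle; rewrite mulrnDr; apply: le_trans (lerD (padT j) (padT j.+2)).
  rewrite -mulrnDl mulrnAC; apply: ler_wMn2r; apply: le_trans Ej.
  by rewrite -[_ *+ c]mulr_natl ler_wpM2r // ger0_norm // (le_trans _ cle) ?ler0n.
suff T_le0 : T <= 0.
  apply/rowP => k; rewrite mxE; apply/eqP; rewrite -normr_le0.
  have := le_trans (tj k isT) T_le0; rewrite /t.
  by case: ifP => _; rewrite pmulrn_lle0.
(* A maximum at [i] gives [5 T <= 4 T]. Elsewhere at most one neighbour of [j] is [i], which gives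
   [8 T <= 7 T]. *)
have [ji|ji] := eqVneq j i.
  have := Ecj 1%N; rewrite ji => /(_ mu_i).
  have -> : (i == i.+1 :> nat) = false by lia.
  have -> : (i.+2 == i.+1 :> nat) = false by lia.
  rewrite mulr1n -ji paddedS -[10%N]/(2 * 5)%N mulrnA.
  have -> : `|y 0 j| *+ 2 = T by rewrite /T /t ji eqxx.
  by rewrite (mulrSr _ 4) gerDl.
have := Ecj 4 (mu_j _ ji).
rewrite paddedS -[10%N]/(5 * 2)%N mulrnA.
have -> : `|y 0 j| *+ 5 = T by rewrite /T /t (negbTE ji).
rewrite -mulrnA => T8; rewrite -(gerDl (T *+ 7)) -mulrSr; apply: le_trans T8 _.
by apply: ler_wpMn2l => //; do 2!case: eqP => ? //; lia.
Qed.
End Eigenvector.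

Lemma jacobi_diag i : jacobi i i = (d i)%:R.
Proof. by rewrite mxE eqxx path_graph_irr addr0. Qed.

Lemma jacobi_offdiag i j : i != j -> jacobi i j = (path_graph i j)%:R.
Proof. by move=> /negbTE ij; rewrite mxE ij mulr0n add0r. Qed.

(** Two eigenvectors for one eigenvalue have a combination with first entry 0, which vanishes by the
    recurrence. Independence of the rows of [P] then makes the first entry of row [k] zero, hence
    the whole row. *)
Lemma jacobi_simple (k l : 'I_n) :
  k != l -> spectral_diag jacobi 0 k != spectral_diag jacobi 0 l.
Proof.
move=> kl; apply/eqP => Dkl; set P := spectralmx jacobi.
have Pk := row_spectralmx_eigen jacobi_herm k.
have Pl := row_spectralmx_eigen jacobi_herm l.
have n_gt0 : (0 < n)%N := leq_ltn_trans (leq0n k) (ltn_ord k).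
pose o := Ordinal n_gt0; pose c : 'rV_n := P l o *: delta_mx 0 k - P k o *: delta_mx 0 l.
have cPE : c *m P = P l o *: row k P - P k o *: row l P.
  by rewrite mulmxBl -!scalemxAl -!rowE.
have cP0 : c *m P = 0.
  apply: (@jacobi_eigen_eq0 _ (spectral_diag jacobi 0 l)).
    rewrite cPE mulmxBl -!scalemxAl Pk Pl Dkl scalerBr !scalerA.
    by rewrite ![spectral_diag _ _ _ * _]mulrC.
  by rewrite -[1%N]/(o.+1) paddedS cPE !mxE; ring.
have c0 : c = 0 by rewrite -(mulmxK (spectral_unit jacobi) c) cP0 mul0mx.
have /eqP Pko : P k o == 0.
  have /rowP/(_ l) := c0; rewrite !mxE !eqxx [l == k]eq_sym (negbTE kl) /=.
  by rewrite mulr0 mulr1 sub0r => /eqP; rewrite oppr_eq0.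
have /negP[] := row_spectralmx_neq0 jacobi k; apply/eqP.
by apply: (jacobi_eigen_eq0 Pk); rewrite -[1%N]/(o.+1) paddedS mxE.
Qed.

End Jacobi.

Lemma exists_path_neighbour n (i : 'I_n) : (1 < n)%N -> exists j, path_graph i j.
Proof.
move=> n_gt1; have i_lt := ltn_ord i; rewrite /path_graph.
have [i0|i0] := posnP i; first by exists (Ordinal n_gt1); rewrite i0.
have i1 : (i.-1 < n)%N by lia.
by exists (Ordinal i1); rewrite /= prednK // eqxx orbT.
Qed.

(** * Contradiction from the gaps between squares *)

Section JacobiGap.
Variables (n : nat) (d : nat -> nat).
Hypotheses (n_gt1 : (1 < n)%N) (d_gt1 : forall k, (1 < d k)%N).
Hypothesis square_eigen : forall (y : 'rV_n) mu, y != 0 ->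
  y *m jacobi n d = mu *: y -> 1 <= mu -> exists q : nat, mu + 1 = (q ^ 2)%:R.

Let J := jacobi n d.
Let J_herm : J \is hermsymmx := jacobi_herm n d.
Let D := spectral_diag J.
Let P := spectralmx J.

Lemma spectral_diag_square l : 1 <= D 0 l -> exists q : nat, D 0 l + 1 = (q ^ 2)%:R.
Proof.
apply: square_eigen (row_spectralmx_eigen J_herm l).
exact: row_spectralmx_neq0.
Qed.

(** For a neighbour [j] of [i], the form at [d_i e_i + e_j] exceeds [c * N] by [d_i + d_j - 1]; the
    summand [1 / N] in [c] makes the bound strict. *)
Lemma spectral_diag_gt_diag (i : 'I_n) : exists l, (d i)%:R < D 0 l.
Proof.
have [j ij] := exists_path_neighbour i n_gt1.
have neq_ij : i != j by apply: contraTneq ij => <-; rewrite path_graph_irr.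
pose v : 'rV[algC]_n := (d i)%:R *: delta_mx 0 i + 1 *: delta_mx 0 j.
have v_neq0 : v != 0.
  apply/eqP => /rowP/(_ j); rewrite !mxE !eqxx [j == i]eq_sym (negbTE neq_ij) /=.
  by rewrite mulr0 add0r mulr1 => /eqP; rewrite oner_eq0.
pose N : algC := (d i ^ 2 + 1)%:R.
have N_gt0 : 0 < N by rewrite ltr0n addn1.
pose c := (d i)%:R + N^-1.
have [||l _ cl] := @rayleigh_spectral_diag _ _ J J_herm v c _ v_neq0.
- by rewrite realD ?realn // realV gtr0_real.
- have -> : (v *m v^t*) 0 0 = N.
    rewrite -[v in v *m _]mulmx1 quadratic_form_delta2 !mxE !eqxx [j == i]eq_sym.
    by rewrite (negbTE neq_ij) normr_nat normr1 /N natrD natrX mulr0n mulr1n; ring.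
  rewrite quadratic_form_delta2 !jacobi_diag !jacobi_offdiag // 1?eq_sym //.
  rewrite [path_graph j i]path_graph_sym ij /c mulrDl mulVf ?gt_eqF //.
  rewrite normr_nat normr1 conjC1 conjC_nat /N -subr_ge0.
  have -> : (d j)%:R = (d j).-1%:R + 1 :> algC by rewrite natr1 prednK // ltnW.
  rewrite (_ : _ - _ = (d i + (d j).-1)%:R) ?ler0n // !natrD natrX /=; ring.
by exists l; apply: lt_le_trans cl; rewrite ltrDl invr_gt0.
Qed.

Lemma spectral_diag_ge_second (i j k : 'I_n) : i != j -> (d j <= d i)%N ->
  exists2 l, l != k & (d j)%:R - 1 <= D 0 l.
Proof.
move=> neq_ij dij.
(* This choice makes [v] orthogonal to row [k] of [P], which forces [l != k]. *)
have [a [b [ab_neq0 ab0]]] := exists_linear_relation2 ((P k i)^*) ((P k j)^*).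
pose v : 'rV[algC]_n := a *: delta_mx 0 i + b *: delta_mx 0 j.
have v_neq0 : v != 0.
  apply: contraTneq ab_neq0 => /rowP v0.
  have := v0 i; have := v0 j; rewrite !mxE !eqxx [j == i]eq_sym (negbTE neq_ij) /=.
  by rewrite !mulr0 !mulr1 addr0 add0r => -> ->; rewrite eqxx.
have [||l ul cl] := @rayleigh_spectral_diag _ _ J J_herm v ((d j)%:R - 1) _ v_neq0.
- by rewrite realB ?realn ?real1.
- have -> : (v *m v^t*) 0 0 = `|a| ^+ 2 + `|b| ^+ 2.
    rewrite -[v in v *m _]mulmx1 quadratic_form_delta2 !mxE !eqxx [j == i]eq_sym.
    by rewrite (negbTE neq_ij) mulr0n mulr1n; ring.
  rewrite quadratic_form_delta2 !jacobi_diag !jacobi_offdiag // 1?eq_sym //.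
  rewrite [path_graph j i]path_graph_sym -subr_ge0.
  have -> : (d i)%:R = (d j)%:R + (d i - d j)%:R :> algC by rewrite -natrD subnKC.
  set p := path_graph i j; set e := (d i - d j)%:R.
  (* The off-diagonal entry [p] is 0 or 1; if it is 1, the sum is [|a + b| ^ 2]. *)
  have sq_ge0 : 0 <= `|a| ^+ 2 + `|b| ^+ 2 + p%:R * (a * b^* + b * a^*).
    case: p; last by rewrite mul0r addr0 addr_ge0 ?exprn_ge0.
    have : 0 <= `|a + b| ^+ 2 by rewrite exprn_ge0.
    by rewrite !normCK rmorphD /=; congr (_ <= _); ring.
  have := addr_ge0 (mulr_ge0 (ler0n _ _ : 0 <= e) (exprn_ge0 2 (normr_ge0 a))) sq_ge0.
  by congr (_ <= _); ring.
exists l => //; apply: contraNneq ul => ->.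
by rewrite mulmxDl -!scalemxAl -!rowE !mxE ab0.
Qed.

Lemma jacobi_gap_contradiction : False.
Proof.
have o : 'I_n := Ordinal (ltnW n_gt1).
have [i _ d_max] := @arg_maxnP _ o xpredT (fun i : 'I_n => d i) isT.
have [k _ D_max] := @real_arg_maxP _ _ o xpredT (fun k => D 0 k) isT
  (fun k _ => spectral_diag_real J_herm k).
have dD : (d i)%:R < D 0 k.
  have [l dl] := spectral_diag_gt_diag i; exact: lt_le_trans dl (D_max l isT).
have [|m Dm] := @spectral_diag_square k.
  by apply: le_trans (ltW dD); rewrite ler1n ltnW.
have DE : D 0 k = (m ^ 2)%:R - 1 by rewrite -Dm addrK.
have dm : (d i + 1 < m ^ 2)%N by rewrite -(ltr_nat algC) natrD -Dm ltrD2r.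
have /eqP[] := row_spectralmx_neq0 J k.
apply: (jacobi_eigen_gershgorin (row_spectralmx_eigen J_herm k) (i := i)).
  by rewrite -/D DE !lerBrDr nat1r natr1 ler_nat; lia.
move=> j neq_ji; have [|l neq_lk jl] := @spectral_diag_ge_second i j k _ (d_max j isT).
  by rewrite eq_sym.
have [|q Dq] := @spectral_diag_square l.
  by apply: le_trans jl; rewrite lerBrDr -[1 + 1]/(2%:R) ler_nat.
have qm : (q ^ 2 < m ^ 2)%N.
  rewrite -(ltr_nat algC) -Dq -Dm ltrD2r lt_neqAle jacobi_simple //.
  exact: D_max l isT.
have dq : (d j <= q ^ 2)%N by rewrite -(ler_nat algC) -Dq -lerBlDr.
have q_gt1 : (1 < q)%N by have := d_gt1 j; case: q {Dq qm} dq => [|[|q]] //; lia.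
have lt_qm : (q < m)%N by rewrite ltn_sqr in qm.
(* From [2 <= q < m] follows [m ^ 2 >= q ^ 2 + 5], so [m ^ 2 - 1 >= d_j + 4]. *)
rewrite -/D DE !lerBrDr -natrD natr1 ler_nat; nia.
Qed.

End JacobiGap.

(* Integrality of the tree forces [mu + 1] to be a square *)
Local Close Scope ring_scope.

Theorem theorem3p4 (n : nat) (r : n.-tuple nat) :
  2 <= n -> ~ integral_graph (@S_tree n r).
Proof.
move=> n_gt1 r_int; apply: (@jacobi_gap_contradiction n (fun k => (nth 0%N r k).+2)) => //.
move=> y mu y_neq0 yP mu_ge1.
have la2 : (sqrtC (mu + 1) ^+ 2 = mu + 1)%R by rewrite sqrtCK.
have mu_gt0 : (0 < mu)%R := lt_le_trans ltr01 mu_ge1.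
have [k yk] : exists k, (y 0 k != 0)%R by apply/rV0Pn.
have /r_int : eigenvalue (adjmx (@S_tree n r)) (sqrtC (mu + 1)%R).
  apply: (@S_tree_eigenvalue n r (ltnW n_gt1) (padded y) mu _ _ _ _ la2 k) => //.
  - exact: padded_gtn.
  - exact: jacobi_eigenP yP.
  - by rewrite paddedS.
  - by rewrite gt_eqF.
(* The nonnegative root is an integer eigenvalue of the tree, hence a natural number [q]. *)
rewrite intrEge0 ?sqrtC_ge0 ?addr_ge0 ?ltW // => /natrP[q qE].
by exists q; rewrite -la2 qE natrX.
Qed.
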